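(* Let $n\ge2$. For all braids $\beta,\beta'$ in the dual braid monoid $B_n^{+*}$, the relation $\beta<^*_n\beta'$ implies $\beta<\beta'$.
   Context: **Braids and the ordering $<$.** $B_n$ ($n\ge 2$) is Artin's braid group with generators $\sigma_1,\dots,\sigma_{n-1}$ and relations $\sigma_i\sigma_j=\sigma_j\sigma_i$ for $|i-j|\ge2$, $\sigma_i\sigma_j\sigma_i=\sigma_j\sigma_i\sigma_j$ for $|i-j|=1$; $B_{m}$ is viewed as a subgroup of $B_n$ for $m\le n$ via $\sigma_i\mapsto\sigma_i$. A word in the letters $\sigma_j^{\pm1}$ is $\sigma_i$-positive if it contains at least one letter $\sigma_i$, no letter $\sigma_i^{-1}$, and no letter $\sigma_j^{\pm1}$ with $j>i$. A braid is $\sigma_i$-positive if at least one word representing it is; it is $\sigma$-positive if it is $\sigma_i$-positive for some $i$. For braids $\beta,\gamma$, $\beta<\gamma$ means that $\beta^{-1}\gamma$ is $\sigma$-positive. **Dual braid monoid.** For $1\le p<q$, $a_{p,q}=\sigma_p\cdots\sigma_{q-2}\,\sigma_{q-1}\,\sigma_{q-2}^{-1}\cdots\sigma_p^{-1}$. $B_n^{+*}$ is the submonoid of $B_n$ generated by the $a_{p,q}$ with $1\le p<q\le n$. Put $\delta_n=\sigma_1\sigma_2\cdots\sigma_{n-1}$ and let $\phi_n(\beta)=\delta_n\beta\delta_n^{-1}$, an automorphism of $B_n^{+*}$. **Splitting.** Let $n\ge3$. The $B_{n-1}^{+*}$-tail of $\beta\in B_n^{+*}$ is the maximal right-divisor of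 $\beta$ (in the monoid $B_n^{+*}$) that lies in $B_{n-1}^{+*}$. For every nontrivial $\beta\in B_n^{+*}$ there is a unique sequence $(\beta_b,\dots,\beta_1)$ of elements of $B_{n-1}^{+*}$ with $\beta_b\ne1$ such that $\beta=\phi_n^{b-1}(\beta_b)\cdots\phi_n(\beta_2)\cdot\beta_1$ and, for each $k\ge1$, the $B_{n-1}^{+*}$-tail of $\phi_n^{b-k}(\beta_b)\cdots\phi_n(\beta_{k+1})$ is trivial. This sequence is the $\phi_n$-splitting of $\beta$. The $\phi_n$-splitting of the trivial braid is $(1)$. **The rotating ordering.** The relation $<^*_n$ on $B_n^{+*}$ is defined recursively: for $n=2$, $a_{1,2}^b<^*_2a_{1,2}^c$ iff $b<c$; for $n\ge3$, $\beta<^*_n\gamma$ iff the $\phi_n$-splitting of $\beta$ is smaller than that of $\gamma$ for the $\mathtt{ShortLex}$-extension of $<^*_{n-1}$, i.e., it is shorter, or both have the same length and, reading from the left (from the highest index), the first entry that differs from its counterpart is $<^*_{n-1}$-smaller. *)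

(* Defs.v *)
From HB Require Import structures.
From mathcomp Require Import all_boot boolp.

Set Implicit Arguments.
Unset Strict Implicit.
Unset Printing Implicit Defensive.

Local Open Scope group_scope.
Local Open Scope quotient_scope.

(* The letter (j, true) is sigma_j and (j, false) is sigma_j^-1. *)
Definition sigma_index n := {j : nat | 0 < j < n}.
Definition letter n := (sigma_index n * bool)%type.
Definition word n := seq (letter n).

Definition winv n (w : word n) : word n := rev [seq (l.1, ~~ l.2) | l <- w].

Inductive braid_eqv n : word n -> word n -> Prop :=
| BraidRefl w : braid_eqv w w
| BraidSym w1 w2 : braid_eqv w1 w2 -> braid_eqv w2 w1
| BraidTrans w1 w2 w3 : braid_eqv w1 w2 -> braid_eqv w2 w3 -> braid_eqv w1 w3
| BraidCat u1 u2 v1 v2 :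
    braid_eqv u1 u2 -> braid_eqv v1 v2 -> braid_eqv (u1 ++ v1) (u2 ++ v2)
| BraidFree i b : braid_eqv [:: (i, b); (i, ~~ b)] [::]
| BraidComm (i j : sigma_index n) : (val i).+1 < val j ->
    braid_eqv [:: (i, true); (j, true)] [:: (j, true); (i, true)]
| BraidRel (i j : sigma_index n) : (val i).+1 = val j ->
    braid_eqv [:: (i, true); (j, true); (i, true)]
              [:: (j, true); (i, true); (j, true)].

Definition braid_eqvb n : rel (word n) := fun w1 w2 => `[< braid_eqv w1 w2 >].

Lemma braid_eqvb_refl n : reflexive (@braid_eqvb n).
Proof. by move=> w; apply/asboolP; constructor. Qed.

Lemma braid_eqvb_sym n : symmetric (@braid_eqvb n).
Proof. by move=> v w; apply/asboolP/asboolP; apply: BraidSym. Qed.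

Lemma braid_eqvb_trans n : transitive (@braid_eqvb n).
Proof.
by move=> v u w /asboolP uv /asboolP vw; apply/asboolP; apply: BraidTrans vw.
Qed.

Canonical braid_equiv n :=
  EquivRel (@braid_eqvb n)
    (@braid_eqvb_refl n) (@braid_eqvb_sym n) (@braid_eqvb_trans n).

Definition braid n := {eq_quot @braid_eqvb n}.

HB.instance Definition _ n := Choice.on (braid n).
HB.instance Definition _ n := EqQuotient.on (braid n).

Section BraidGroup.
Variable n : nat.
Implicit Types (w : word n) (x y z : braid n).

Definition braid_of w : braid n := \pi_(braid n) w.

Lemma braid_ofP w1 w2 : braid_of w1 = braid_of w2 <-> braid_eqv w1 w2.
Proof. by split=> [/eqmodP/asboolP|h]; last exact/eqmodP/asboolP. Qed.

Lemma braid_of_repr x : braid_of (repr x) = x.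
Proof. exact: reprK. Qed.

Lemma repr_braid_of w : braid_eqv (repr (braid_of w)) w.
Proof. by apply/braid_ofP; rewrite braid_of_repr. Qed.

Lemma winvK : involutive (@winv n).
Proof.
move=> w; rewrite /winv map_rev revK -map_comp map_id_in // => -[i b] _ /=.
by rewrite negbK.
Qed.

Lemma winv_cat w1 w2 : winv (w1 ++ w2) = winv w2 ++ winv w1.
Proof. by rewrite /winv map_cat rev_cat. Qed.

Lemma winv_catl w : braid_eqv (winv w ++ w) [::].
Proof.
elim: w => [|[i b] w IHw]; first exact: BraidRefl.
rewrite -cat1s winv_cat -catA (catA _ [:: _] w).
apply: BraidTrans IHw; apply: BraidCat; first exact: BraidRefl.
rewrite -[X in braid_eqv _ X]cat0s; apply: BraidCat; last exact: BraidRefl.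
by have := BraidFree i (~~ b); rewrite negbK.
Qed.

Lemma winv_catr w : braid_eqv (w ++ winv w) [::].
Proof. by have := winv_catl (winv w); rewrite winvK. Qed.

Lemma winv_eqv w1 w2 : braid_eqv w1 w2 -> braid_eqv (winv w1) (winv w2).
Proof.
move=> e; apply: (@BraidTrans _ _ (winv w1 ++ (w2 ++ winv w2))).
  rewrite -[X in braid_eqv X _]cats0; apply: BraidCat; first exact: BraidRefl.
  by apply: BraidSym; apply: winv_catr.
rewrite catA -[X in braid_eqv _ X]cat0s; apply: BraidCat; last exact: BraidRefl.
apply: (@BraidTrans _ _ (winv w1 ++ w1)); last exact: winv_catl.
by apply: BraidCat; [exact: BraidRefl | exact: BraidSym].
Qed.

Definition braid_mul x y := braid_of (repr x ++ repr y).
Definition braid_inv x := braid_of (winv (repr x)).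

Lemma braid_of_cat w1 w2 :
  braid_of (w1 ++ w2) = braid_mul (braid_of w1) (braid_of w2).
Proof.
by apply/braid_ofP/BraidSym/BraidCat; apply: repr_braid_of.
Qed.

Lemma braid_of_inv w : braid_of (winv w) = braid_inv (braid_of w).
Proof. by apply/braid_ofP/winv_eqv/BraidSym/repr_braid_of. Qed.

Lemma braid_mulA : associative braid_mul.
Proof.
move=> x y z; rewrite -(braid_of_repr x) -(braid_of_repr y) -(braid_of_repr z).
by rewrite -!braid_of_cat catA.
Qed.

Lemma braid_mul1g : left_id (braid_of [::]) braid_mul.
Proof. by move=> x; rewrite -(braid_of_repr x) -braid_of_cat. Qed.

Lemma braid_mulg1 : right_id (braid_of [::]) braid_mul.
Proof. by move=> x; rewrite -(braid_of_repr x) -braid_of_cat cats0. Qed.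

Lemma braid_mulVg : left_inverse (braid_of [::]) braid_inv braid_mul.
Proof.
move=> x; rewrite -(braid_of_repr x) -braid_of_inv -braid_of_cat.
by apply/braid_ofP/winv_catl.
Qed.

Lemma braid_mulgV : right_inverse (braid_of [::]) braid_inv braid_mul.
Proof.
move=> x; rewrite -(braid_of_repr x) -braid_of_inv -braid_of_cat.
by apply/braid_ofP/winv_catr.
Qed.

End BraidGroup.

HB.instance Definition _ n :=
  isGroup.Build (braid n) (@braid_mulA n) (@braid_mul1g n) (@braid_mulg1 n)
    (@braid_mulVg n) (@braid_mulgV n).

Section Orderings.
Variable n : nat.
Implicit Types (x y : braid n) (m : nat).

(* Only the values for 0 < j < n are meaningful. *)
Definition sigma (j : nat) : braid n :=
  if insub j is Some i then braid_of [:: (i, true)] else 1.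

Definition positive_word (i : sigma_index n) (w : word n) : bool :=
  [&& (i, true) \in w, (i, false) \notin w & all (fun l => val l.1 <= val i) w].

Definition sigma_positive x : Prop :=
  exists i w, positive_word i w /\ braid_of w = x.

Definition braid_lt x y : Prop := sigma_positive (x^-1 * y).

Definition band (p q : nat) : braid n :=
  let c := \big[*%g/1]_(p <= j < q.-1) sigma j in c * sigma q.-1 * c^-1.

(* B_m, for m <= n, is the subgroup of B_n generated by sigma_1, ...,
   sigma_(m-1); accordingly, everything below that is indexed by m takes place
   inside B_n. *)

Inductive dual m : braid n -> Prop :=
| Dual1 : dual m 1
| DualBand p q : 0 < p -> p < q -> q <= m -> dual m (band p q)
| DualM x y : dual m x -> dual m y -> dual m (x * y).

Definition right_divides m x y : Prop := exists2 z, dual m z & y = z * x.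

Definition delta m : braid n := \big[*%g/1]_(1 <= j < m) sigma j.

Definition phi m x : braid n := delta m * x * (delta m)^-1.

Definition is_tail m x t : Prop :=
  [/\ dual m.-1 t, right_divides m t x
    & forall y, dual m.-1 y -> right_divides m y x -> right_divides m y t].

(* The sequence (beta_b, ..., beta_1) is stored in this order: beta_k is the
   entry of s of index b - k, where b = size s. *)
Definition is_splitting m x (s : seq (braid n)) : Prop :=
  let b := size s in
  (x = 1 /\ s = [:: 1]) \/
  [/\ x <> 1, (forall y, y \in s -> dual m.-1 y), head 1 s <> 1,
      x = \big[*%g/1]_(0 <= i < b) iter (b - i.+1) (phi m) (nth 1 s i)
    & forall k, 0 < k ->
        is_tail m
          (\big[*%g/1]_(0 <= i < b - k) iter (b - k - i) (phi m) (nth 1 s i))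
          1].

Definition shortlex (lt : braid n -> braid n -> Prop) (s t : seq (braid n)) :
    Prop :=
  size s < size t \/
  size s = size t /\
  exists i, [/\ i < size s, (forall j, j < i -> nth 1 s j = nth 1 t j),
                nth 1 s i <> nth 1 t i & lt (nth 1 s i) (nth 1 t i)].

Fixpoint rotating_lt m x y : Prop :=
  match m with
  | 0 | 1 => False
  | 2 => exists b c, [/\ x = band 1 2 ^+ b, y = band 1 2 ^+ c & b < c]
  | m'.+1 => exists s t, [/\ is_splitting m x s, is_splitting m y t
                           & shortlex (rotating_lt m') s t]
  end.

End Orderings.

(* Main.v *)
Require Import Defs.
From mathcomp Require Import all_boot zify.

(* Let n = m+1, and write x_k = phi_n(x_{k+1}) b_k, y_k = phi_n(y_{k+1}) c_k
   for the partial products of two splittings, so that x_1 = x and y_1 = y.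
   Then v_k = x_k^-1 y_k satisfies v_k = b_k^-1 phi_n(v_{k+1}) c_k. Below the
   first place where the splittings differ, v_k stays sigma_m-positive. The
   danger is the factor delta_n^-1 brought in on the right by phi_n; it is
   absorbed, since phi_n(y_{k+1}) ends with some band a_{p,n}, while phi_n(y_k)
   has no right divisor in B_{n-1}: this forces the letters of c_k to climb
   from p to m by crossings r < p < s (a ladder), each of which moves the last
   sigma_m of a word representing v_k further to the right, until it cancels
   the sigma_m^-1 of delta_n^-1. At the first difference, v_k = b_k^-1 c_k is
   handled by induction on n: for k >= 2 the entries have a trivial
   B_{n-2}-tail, so they already differ before the last entry of their own
   splittings. *)

Set Implicit Arguments.
Unset Strict Implicit.
Unset Printing Implicit Defensive.

Local Open Scope group_scope.

Section Braids.
Variable N : nat.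
Implicit Types (x y z g k : braid N) (a b e i j m p q r s t u : nat).
Local Notation S := (@sigma N).
Local Notation A := (@band N).

(** * Generators and runs of consecutive generators *)

Lemma mul_braid_of (v w : word N) : braid_of v * braid_of w = braid_of (v ++ w).
Proof. by rewrite braid_of_cat. Qed.

Lemma sigma_oob j : ~~ (0 < j < N) -> S j = 1.
Proof. by move=> h; rewrite /sigma insubN. Qed.

Lemma sigma_in j (h : 0 < j < N) :
  S j = braid_of [:: (exist _ j h : sigma_index N, true)].
Proof. by rewrite /sigma insubT. Qed.

Lemma sigma_comm i j : i.+1 < j -> commute (S i) (S j).
Proof.
move=> ij; case: (boolP (0 < i < N)) => hi; last first.
  by rewrite (sigma_oob hi); apply/commute_sym/commute1.
case: (boolP (0 < j < N)) => hj; last by rewrite (sigma_oob hj); apply/commute1.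
by rewrite /commute !sigma_in !mul_braid_of; apply/braid_ofP/BraidComm.
Qed.

Lemma sigma_braid i : 0 < i -> i.+1 < N ->
  S i * S i.+1 * S i = S i.+1 * S i * S i.+1.
Proof.
move=> i0 iN; have h1 : 0 < i < N by lia.
have h2 : 0 < i.+1 < N by [].
by rewrite (sigma_in h1) (sigma_in h2) !mul_braid_of; apply/braid_ofP/BraidRel.
Qed.

Definition srun a b : braid N := \big[*%g/1]_(a <= j < b) S j.

Lemma srun_geq a b : b <= a -> srun a b = 1.
Proof. by move=> h; rewrite /srun big_geq. Qed.

Lemma srunSr a b : a <= b -> srun a b.+1 = srun a b * S b.
Proof. by move=> h; rewrite /srun big_nat_recr. Qed.

Lemma srunSl a b : a < b -> srun a b = S a * srun a.+1 b.
Proof. by move=> h; rewrite /srun big_ltn. Qed.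

Lemma srun_cat a b e : a <= b -> b <= e -> srun a e = srun a b * srun b e.
Proof. by move=> ab be; rewrite /srun (big_cat_nat ab be). Qed.

(** * Subgroups generated by consecutive generators, and nonnegative braids *)

Inductive gen a b : braid N -> Prop :=
| gen1 : gen a b 1
| genS j : a <= j < b -> gen a b (S j)
| genM x y : gen a b x -> gen a b y -> gen a b (x * y)
| genV x : gen a b x -> gen a b x^-1.

Lemma gen_sub a b a' b' x : a' <= a -> b <= b' -> gen a b x -> gen a' b' x.
Proof.
move=> ha hb; elim=> [|j h|y z _ hy _ hz|y _ hy].
- exact: gen1.
- by apply: genS; lia.
- exact: genM.
- exact: genV.
Qed.

Lemma gen_comm a b x y :
  (forall j, a <= j < b -> commute (S j) y) -> gen a b x -> commute x y.
Proof.
move=> h; elim=> [|j /h //|u v _ hu _ hv|u _ hu].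
- by apply/commute_sym/commute1.
- by apply/commute_sym/commuteM; apply/commute_sym.
- by apply/commute_sym/commuteV/commute_sym.
Qed.

Lemma gen_geq a b x : b <= a -> gen a b x -> x = 1.
Proof.
move=> ba; elim=> [|j|y z _ -> _ ->|y _ ->] //; first by lia.
  by rewrite mulg1.
by rewrite invg1.
Qed.

Lemma gen_gen_comm a b a' b' x y :
  b < a' -> gen a b x -> gen a' b' y -> commute x y.
Proof.
move=> h hx hy; apply: gen_comm hx => j hj; apply/commute_sym.
apply: gen_comm hy => i hi; apply/commute_sym/sigma_comm; lia.
Qed.

Lemma gen_conj a b a' b' c x :
    (forall j, a <= j < b -> gen a' b' (S j ^ c)) -> gen a b x ->
  gen a' b' (x ^ c).
Proof.
move=> h; elim=> [|j /h //|u v _ hu _ hv|u _ hu].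
- by rewrite conj1g; apply: gen1.
- by rewrite conjMg; apply: genM.
- by rewrite conjVg; apply: genV.
Qed.

Lemma gen_srun a b : gen a b (srun a b).
Proof.
elim: b => [|b IH]; first by rewrite srun_geq //; apply: gen1.
case: (leqP a b) => ab; last by rewrite srun_geq //; apply: gen1.
rewrite srunSr //; apply: genM; last by apply: genS; lia.
by apply: gen_sub IH; lia.
Qed.

Lemma gen_srun_sub a b a' b' : a' <= a -> b <= b' -> gen a' b' (srun a b).
Proof. by move=> ha hb; apply: gen_sub (gen_srun a b). Qed.

(* The braids of B_m with a word in which the top generator sigma_{m-1} only
   occurs positively; for m <= 1 the factor S m.-1 is the junk value 1. *)
Inductive nonneg m : braid N -> Prop :=
| nonneg_gen x : gen 1 m.-1 x -> nonneg m x
| nonneg_cons y x :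
    gen 1 m.-1 y -> nonneg m x -> nonneg m (y * S m.-1 * x).

Lemma nonneg1 m : nonneg m 1.
Proof. exact/nonneg_gen/gen1. Qed.

Lemma nonnegM m x y : nonneg m x -> nonneg m y -> nonneg m (x * y).
Proof.
elim=> [b hb hy|b z hb _ IH hy]; last by rewrite -mulgA; apply/nonneg_cons/IH.
case: hy => [z hz|c z hc hz]; first by apply/nonneg_gen/genM.
by rewrite !mulgA; apply: nonneg_cons hz; apply: genM.
Qed.

Lemma nonneg_sigma m : nonneg m (S m.-1).
Proof.
by rewrite -[S _]mul1g -[_ * _]mulg1; apply: nonneg_cons (nonneg1 _);
  apply: gen1.
Qed.

Lemma nonneg_sub m x : nonneg m x -> gen 1 m x.
Proof.
have sm : gen 1 m (S m.-1).
  by case: m => [|[|m]] /=; rewrite ?(@sigma_oob 0) //; try exact: gen1;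
    apply: genS; lia.
have sg y : gen 1 m.-1 y -> gen 1 m y by apply: gen_sub => //; lia.
by elim=> [y /sg//|y z /sg hy _ hz]; do 2?apply: genM.
Qed.

Lemma nonneg_lt p m x : p < m -> nonneg p x -> nonneg m x.
Proof.
by move=> pm /nonneg_sub h; apply: nonneg_gen; apply: gen_sub h => //; lia.
Qed.

Lemma nonneg_le p m x : p <= m -> nonneg p x -> nonneg m x.
Proof. by rewrite leq_eqVlt => /predU1P[->//|]; apply: nonneg_lt. Qed.

Lemma nonneg_conj m m' c x :
    (forall j, 0 < j < m.-1 -> gen 1 m'.-1 (S j ^ c)) ->
    nonneg m' (S m.-1 ^ c) -> nonneg m x ->
  nonneg m' (x ^ c).
Proof.
move=> hj hm; elim=> [b hb|b z hb _ IH].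
  by apply: nonneg_gen; apply: gen_conj hb.
rewrite !conjMg; apply: nonnegM => //; apply: nonnegM => //.
by apply: nonneg_gen; apply: gen_conj hb.
Qed.

Lemma nonneg_last m x : nonneg m x ->
  gen 1 m.-1 x \/
  exists z g, [/\ nonneg m z, gen 1 m.-1 g & x = z * S m.-1 * g].
Proof.
elim=> [b|b y hb _ [hy|[q [c [hq hc ->]]]]]; first by left.
  by right; exists b, y; split => //; apply: nonneg_gen.
right; exists (b * S m.-1 * q), c; split => //; last by rewrite !mulgA.
exact: nonneg_cons.
Qed.

(** * Conjugation by generators and runs *)

Lemma conj_fix x y : commute x y -> x ^ y = x.
Proof. by move=> h; rewrite conjgE h mulKg. Qed.

Lemma conj_of x y z : x * y = y * z -> x ^ y = z.
Proof. by move=> h; rewrite conjgE h mulKg. Qed.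

Lemma srun_comm a b j : (j.+1 < a) || (b < j) -> commute (S j) (srun a b).
Proof.
move=> h; apply/commute_sym; apply: gen_comm (gen_srun a b) => i hi.
case: (ltngtP i j) => hij; last by lia.
- by apply: sigma_comm; lia.
- by apply/commute_sym/sigma_comm; lia.
Qed.

Lemma sigma_conj_up i : 0 < i -> i.+1 < N ->
  S i.+1 ^ (S i)^-1 = S i ^ S i.+1.
Proof.
move=> i0 iN; rewrite !conjgE invgK.
by apply: (mulgI (S i.+1)); rewrite mulVKg !mulgA -sigma_braid // mulgK.
Qed.

Lemma sigma_conj_down i : 0 < i -> i.+1 < N ->
  S i ^ (S i.+1)^-1 = S i.+1 ^ S i.
Proof.
move=> i0 iN; rewrite !conjgE invgK.
by apply: (mulgI (S i)); rewrite mulVKg !mulgA sigma_braid // mulgK.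
Qed.

Lemma srun_shift a b j : 0 < a -> b <= N -> a <= j -> j.+1 < b ->
  srun a b * S j = S j.+1 * srun a b.
Proof.
move=> a0 bN aj jb.
rewrite (@srun_cat a j b) ?(@srunSl j b) ?(@srunSl j.+1 b) //; try lia.
have c1 : commute (srun j.+2 b) (S j).
  by apply/commute_sym/srun_comm; lia.
have c2 : commute (srun a j) (S j.+1).
  by apply/commute_sym/srun_comm; lia.
rewrite -!mulgA c1 !mulgA -c2; congr (_ * _).
by rewrite -!mulgA; congr (_ * _); rewrite !mulgA sigma_braid //; lia.
Qed.

Lemma gen_shift a b g : 0 < a -> b <= N -> gen a.+1 b g ->
  gen a b.-1 (g ^ srun a b).
Proof.
move=> a0 bN; apply: gen_conj => -[//|j] hj.
rewrite (@conj_of _ _ (S j)); first by apply: genS; lia.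
by rewrite srun_shift //; lia.
Qed.

(** Lower generators commute with [S m], and the top one satisfies
    $\sigma_m\sigma_{m-1}\sigma_m^{-1}=\sigma_{m-1}^{-1}\sigma_m\sigma_{m-1}$. *)
Lemma nonneg_up m x : m < N -> nonneg m x -> nonneg m.+1 (x ^ (S m)^-1).
Proof.
move=> mN; apply: nonneg_conj => [j hj|].
  rewrite conj_fix; first by apply: genS; lia.
  by apply/commuteV/sigma_comm; lia.
case: m mN => [|[|m]] mN; rewrite ?(@sigma_oob 0) ?conj1g //;
  try exact: nonneg1.
rewrite [_.-1]/= sigma_conj_down // conjgE; apply: nonnegM.
  by apply/nonneg_gen/genV/genS; lia.
by apply: nonnegM; [exact: (nonneg_sigma m.+3)|apply/nonneg_gen/genS; lia].
Qed.

(** Since $\sigma_s^{-1}\sigma_{s-1}\sigma_s=\sigma_{s-1}\sigma_s\sigma_{s-1}^{-1}$, the positive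
    top letter climbs along the run. *)
Lemma nonneg_run p s x : p <= s -> s <= N -> nonneg p x ->
  nonneg s (x ^ srun p s).
Proof.
elim: s => [|s IH] ps sN hx.
  by rewrite srun_geq // conjg1 (_ : 0 = p) //; lia.
move: ps; rewrite leq_eqVlt => /predU1P[<-|ps].
  by rewrite srun_geq // conjg1.
rewrite srunSr // conjgM.
have {IH}: nonneg s (x ^ srun p s) by apply: IH => //; lia.
apply: nonneg_conj => [j hj|].
  rewrite conj_fix; first by apply: genS; lia.
  by apply/sigma_comm; lia.
case: s ps sN => [|[|m]] ps mN; rewrite ?(@sigma_oob 0) ?conj1g //;
  try exact: nonneg1.
rewrite [_.-1]/= -sigma_conj_up // conjgE invgK; apply: nonnegM.
  by apply/nonneg_gen/genS; lia.
by apply: nonnegM; [exact: (nonneg_sigma m.+3)|apply/nonneg_gen/genV/genS; lia].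
Qed.

(** * The rotation automorphism [phi] *)

Lemma phiE m x : phi m x = x ^ (delta N m)^-1.
Proof. by rewrite conjgE invgK mulgA. Qed.

Lemma phiM m x y : phi m (x * y) = phi m x * phi m y.
Proof. by rewrite !phiE conjMg. Qed.

Lemma phiV m x : phi m x^-1 = (phi m x)^-1.
Proof. by rewrite !phiE conjVg. Qed.

Lemma phi1 m : phi m 1 = 1 :> braid N.
Proof. by rewrite phiE conj1g. Qed.

Lemma phi_sigma m j : m <= N -> 0 < j -> j.+1 < m -> phi m (S j) = S j.+1.
Proof. by move=> mN j0 jm; rewrite /phi srun_shift // mulgK. Qed.

Lemma phi_gen m a b x : m <= N -> 0 < a -> b < m ->
  gen a b x -> gen a.+1 b.+1 (phi m x).
Proof.
move=> mN a0 bm hx; rewrite phiE; apply: gen_conj hx => j hj.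
by rewrite -phiE phi_sigma //; [apply: genS|..]; lia.
Qed.

Lemma phi_srun m a b : m <= N -> 0 < a -> b < m ->
  phi m (srun a b) = srun a.+1 b.+1.
Proof.
move=> mN a0; elim: b => [|b IH] bm; first by rewrite !srun_geq // phi1.
case: (leqP a b) => ab; last by rewrite !srun_geq // phi1.
rewrite (srunSr ab) (@srunSr a.+1 b.+1) // phiM IH; last by lia.
by rewrite phi_sigma //; lia.
Qed.

Lemma phi_nonneg m p x : m <= N -> p < m ->
  nonneg p x -> nonneg p.+1 (phi m x).
Proof.
move=> mN pm; rewrite phiE; apply: nonneg_conj => [j hj|].
  by rewrite -phiE phi_sigma //; [apply: genS|..]; lia.
case: p pm => [|[|p]] pm; rewrite ?(@sigma_oob 0) ?conj1g //;
  try exact: nonneg1.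
by rewrite -phiE phi_sigma //; exact: (nonneg_sigma p.+3).
Qed.

(** * Band generators *)

Lemma band_def p q : A p q = srun p q.-1 * S q.-1 * (srun p q.-1)^-1.
Proof. by []. Qed.

Lemma delta_srun m : delta N m = srun 1 m.
Proof. by []. Qed.

Lemma band_srun p q : p < q -> A p q = srun p q * (srun p q.-1)^-1.
Proof.
by case: q => // q pq; rewrite band_def (@srunSr p q).
Qed.

(** Conjugation by a run lowers the indices by one; this links the two expressions [band_srun] and
    [bandE] of a band. *)
Lemma srun_srun a b : 0 < a -> a < b -> b <= N ->
  srun a b * srun a b.-1 = srun a.+1 b * srun a b.
Proof.
move=> a0 ab bN; case: b ab bN => // b ab bN.
suff h c : c <= b -> srun a c = srun a.+1 c.+1 ^ srun a b.+1.
  by rewrite (h b) // conjgE mulVKg.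
elim: c => [|c IH] cb; first by rewrite (@srun_geq a) // (@srun_geq a.+1)
  ?conj1g.
case: (leqP a c) => ac; last by rewrite (@srun_geq a) // (@srun_geq a.+1)
  ?conj1g.
rewrite (srunSr ac) (@srunSr a.+1 c.+1) // conjMg -IH; last by lia.
congr (_ * _); apply/esym/conj_of; rewrite srun_shift //; lia.
Qed.

Lemma bandE p q : 0 < p -> p < q -> q <= N -> A p q = S p ^ srun p.+1 q.
Proof.
move=> p0 pq qN; rewrite band_srun // conjgE -srunSl //.
apply: (mulgI (srun p.+1 q)); rewrite mulVKg mulgA -srun_srun //.
by rewrite mulgK.
Qed.

Lemma band_gen p q : p < q -> gen p q (A p q).
Proof.
move=> pq; rewrite band_srun //; apply: genM; first exact: gen_srun.
by apply: genV; apply: gen_srun_sub => //; lia.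
Qed.

Lemma band_nonneg m p q : 0 < p -> p < q -> q <= m -> nonneg m (A p q).
Proof.
move=> p0 pq qm.
suff : nonneg q (A p q) by apply: nonneg_le.
case: q pq qm => // q pq qm; rewrite band_def; apply: nonnegM.
  apply: nonnegM (nonneg_sigma _).
  by apply/nonneg_gen/gen_srun_sub => /=; lia.
by apply/nonneg_gen/genV/gen_srun_sub => /=; lia.
Qed.

Lemma band_comm_in p q j : 0 < p -> q <= N -> p < j -> j < q.-1 ->
  commute (S j) (A p q).
Proof.
move=> p0 qN; case: j => // j pj jq; rewrite band_srun; last by lia.
rewrite /commute mulgA -srun_shift //; try lia.
rewrite -!mulgA; congr (_ * _); apply: (mulgI (srun p q.-1)).
rewrite mulgA srun_shift //; try lia.
by rewrite mulgK mulVKg.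
Qed.

Lemma band_comm_out p q r s : r < s -> s < p -> p < q ->
  commute (A r s) (A p q).
Proof. by move=> rs sp pq; apply: gen_gen_comm (band_gen rs) (band_gen pq). Qed.

Lemma band_comm_nest p q r s : 0 < p -> q <= N -> p < r -> r < s -> s < q ->
  commute (A r s) (A p q).
Proof.
move=> p0 qN pr rs sq; apply: gen_comm (band_gen rs) => j hj.
by apply: band_comm_in; lia.
Qed.

(** Together with [band_conj'], this yields the relations
    $a_{t,r}a_{r,s}=a_{r,s}a_{t,s}=a_{t,s}a_{t,r}$ of the dual presentation. *)
Lemma band_conj t r s : t < r -> r < s -> A t r * A r s = A t s * A t r.
Proof.
move=> tr rs.
have -> : A t s = A r s ^ (srun t r)^-1.
  by rewrite conjgE invgK !band_def (@srun_cat t r s.-1) ?invgM ?mulgA //; lia.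
have -> : srun t r = A t r * srun t r.-1 by rewrite band_srun // mulgVK.
rewrite invgM conjgM (@conj_fix (A r s)).
  by rewrite conjgE invgK; move: (A t r) (A r s) => x y; rewrite mulgA mulgVK.
apply: commuteV; apply/commute_sym.
apply: gen_gen_comm (gen_srun _ _) (band_gen rs); lia.
Qed.

Lemma band_conj' r s q : 0 < r -> r < s -> s < q -> q <= N ->
  A r q * A r s = A s q * A r q.
Proof.
move=> r0 rs sq qN.
have E : A r s * A s q = A r q * A r s by apply: band_conj.
have c1 : commute (srun r s.-1) (A s q).
  by apply: gen_gen_comm (gen_srun _ _) (band_gen sq); lia.
have c2 : commute (srun s.+1 q) (S s.-1).
  by apply/commute_sym/srun_comm; lia.
(* Two conjugations reduce the pair of bands to $\sigma_{s-1},\sigma_s$, for which this is the braid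
   relation. *)
have B : A r s * A s q * A r s = A s q * A r s * A s q.
  have -> : A r s = S s.-1 ^ (srun r s.-1)^-1 by rewrite conjgE invgK band_def
    mulgA.
  rewrite -(conj_fix (commuteV (commute_sym c1))) -!conjMg; congr (_ ^ _).
  rewrite bandE //; last by lia.
  rewrite -(conj_fix (commute_sym c2)) -!conjMg; congr (_ ^ _).
  by case: s rs sq {E c1 c2} => // s rs sq /=; rewrite sigma_braid //; lia.
move: E B; move: (A r s) (A s q) (A r q) => x y z E B.
by apply: (mulIg x); rewrite -E B -[RHS]mulgA -E mulgA.
Qed.

Lemma phi_band m p q : m <= N -> 0 < p -> p < q -> q < m ->
  phi m (A p q) = A p.+1 q.+1.
Proof.
move=> mN p0 pq qm; rewrite (band_srun pq) (@band_srun p.+1 q.+1) //.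
rewrite phiM phiV !phi_srun //; try lia.
by rewrite prednK //; lia.
Qed.

Lemma phi_band_top m p : m <= N -> 0 < p -> p < m ->
  phi m (A p m) = A 1 p.+1.
Proof.
move=> mN p0 pm; rewrite /phi (bandE p0 pm mN); apply: (mulIg (delta N m)).
rewrite mulgVK band_srun // delta_srun (@srun_cat 1 p.+1 m) //=.
by rewrite conjgE srunSr // !mulgA mulgK mulgVK.
Qed.

(** * Positivity with a controlled right end *)

Lemma mulg3_congr (w a b c a' b' c' : braid N) :
  a * b * c = a' * b' * c' -> w * a * b * c = w * a' * b' * c'.
Proof. by move=> h; rewrite -!mulgA (mulgA a) h !mulgA. Qed.

(* In rank m+1, the factors g and k commute with the bands a_{r,s} of B_m for
   s < p, resp. for r > p; the barriers r < p < s move p up to s. For p = 1 this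
   is sigma_m-positivity; for p = m it says that x * sigma_m^-1 is
   sigma_m-nonnegative. *)
Definition reach m p x : Prop := exists z g k,
  [/\ nonneg m.+1 z, gen p m g, nonneg p k & x = z * S m * g * k].

Lemma reachMl m p x z : nonneg m.+1 z -> reach m p x -> reach m p (z * x).
Proof.
move=> hz [y [g [k [hy hg hk ->]]]]; exists (z * y), g, k.
by split => //; [apply: nonnegM|rewrite !mulgA].
Qed.

Lemma reachMr m p x k : nonneg p k -> reach m p x -> reach m p (x * k).
Proof.
move=> hk [y [g [h [hy hg hh ->]]]]; exists y, g, (h * k).
by split => //; [apply: nonnegM|rewrite !mulgA].
Qed.

Lemma nonneg_swap m x : m < N -> nonneg m x ->
  exists2 z, nonneg m.+1 z & S m * x = z * S m.
Proof.
move=> mN hx; exists (x ^ (S m)^-1); first exact: nonneg_up.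
by rewrite conjgE invgK -!mulgA mulVg mulg1.
Qed.

Lemma reach_top m x : m < N -> reach m m x ->
  exists2 z, nonneg m.+1 z & x = z * S m.
Proof.
move=> mN [z [g [k [hz /gen_geq-> // /(nonneg_swap mN)[y hy E] ->]]]].
exists (z * y); first exact: nonnegM.
by rewrite mulg1 -mulgA E mulgA.
Qed.

Lemma nonneg_gen_run m q h : 0 < q -> q < m -> gen q m.-1 h ->
  nonneg m (srun q m * h).
Proof.
case: m => // m q0 qm hh; rewrite srunSr //; apply: nonnegM.
  apply: nonnegM; last exact: nonneg_sigma.
  by apply/nonneg_gen/gen_srun_sub.
by apply: nonneg_gen; apply: gen_sub hh.
Qed.

Lemma gen_run_swap m q g : 0 < q -> q < m -> m < N -> gen q.+1 m g ->
  exists2 h, gen q m.-1 h & g * srun q m = srun q m * h.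
Proof.
move=> q0 qm mN hg; exists (g ^ srun q m); first by apply: gen_shift => //; lia.
by rewrite conjgE mulVKg.
Qed.

(** Once [k] is moved to the right of the run, [S q * srun q.+1 s] is completed to [srun q m] at the
    cost of [(srun s m)^-1]. The letter [S m] crosses the completed run by [nonneg_swap], which
    raises the barrier to [s]. *)
Lemma reach_run m s q g x k : 0 < q -> q.+1 < s -> s <= m -> m < N ->
    gen q.+1 m g -> gen 1 q x -> nonneg q.+1 k ->
  reach m s (S m * g * x * S q * k * srun q.+1 s).
Proof.
move=> q0 qs sm mN hg hx hk.
have [h hh Eh] : exists2 h, gen q m.-1 h & g * srun q m = srun q m * h.
  by apply: gen_run_swap => //; lia.
have [z hz Ez] : exists2 z, nonneg m.+1 z & S m * (srun q m * h) = z * S m.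
  by apply: nonneg_swap => //; apply: nonneg_gen_run => //; lia.
have c1 : commute x g by apply: gen_gen_comm hx hg.
have c2 : commute x (S m) by apply: (gen_gen_comm _ hx (@genS m m.+1 m _)); lia.
have Es : S q * srun q.+1 s = srun q m * (srun s m)^-1.
  by rewrite -srunSl ?(@srun_cat q s m) ?mulgK //; lia.
exists (x * z), (srun s m)^-1, (k ^ srun q.+1 s); split.
- by apply: nonnegM => //; apply: nonneg_gen; apply: gen_sub hx => /=; lia.
- exact/genV/gen_srun.
- by apply: nonneg_run => //; lia.
rewrite conjgE -[_ * S m]mulgA -Ez -Eh.
move: (srun s m) (srun q m) (srun q.+1 s) Es => a b c Es.
have -> : S m * g * x * S q * k * c = S m * g * x * (S q * c) * c^-1 * k * c.
  by rewrite mulgA mulgK.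
rewrite Es !mulgA; do 5!congr (_ * _).
by rewrite -[LHS]mulgA -c1 mulgA -c2.
Qed.

Lemma nonneg_first m q x : nonneg q.+1 x ->
  exists y k, [/\ gen 1 q y, nonneg q.+1 k & x * S q = y * S q * k].
Proof.
case=> [y hy|y z hy hz].
  by exists y, 1; split => //; [exact: nonneg1|rewrite mulg1].
exists y, (z * S q); split => //; last by rewrite !mulgA.
by apply: nonnegM => //; apply: (@nonneg_sigma q.+1).
Qed.

Lemma reach_low m p r s x : 0 < r -> r < s -> s <= p ->
  reach m p x -> reach m p (x * A r s).
Proof. by move=> r0 rs sp; apply/reachMr/band_nonneg. Qed.

Lemma reach_high m p r s x : p < r -> r < s -> s <= m ->
  reach m p x -> reach m p (x * A r s).
Proof.
move=> pr rs sm [z [g [k [hz hg hk ->]]]]; exists z, (g * A r s), k;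
  split => //.
  by apply: genM hg _; apply: gen_sub (band_gen rs) => //; lia.
have c : commute k (A r s).
  by apply: gen_gen_comm (nonneg_sub hk) (band_gen rs).
by move: (A r s) c => y c; rewrite -!mulgA c.
Qed.

Lemma band_run r p s : r <= p -> p < s ->
  A r s = srun r p * srun p s * (srun r s.-1)^-1.
Proof. by move=> rp ps; rewrite band_srun ?(@srun_cat r p s) //; lia. Qed.

Lemma nonneg_srunV r s : 0 < r -> nonneg s (srun r s.-1)^-1.
Proof. by move=> r0; apply/nonneg_gen/genV/gen_srun_sub. Qed.

(** The run of a crossing band contains [S p.-1]; this letter, or an earlier one in [k], is the
    [S q] of [reach_run]. *)
Lemma reach_cross m p r s x : 0 < r -> r < p -> p < s -> s <= m -> m < N ->
  reach m p x -> reach m s (x * A r s).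
Proof.
case: p => // q r0 rp ps sm mN [z [g [k [hz hg hk ->]]]].
have [y [h [hy hh E]]] :
    exists y h, [/\ gen 1 q y,
      nonneg q.+1 h & k * srun r q * S q = y * S q * h].
  apply: nonneg_first => //; apply: nonnegM => //.
  exact/nonneg_gen/gen_srun_sub.
have -> : z * S m * g * k * A r s =
    z * (S m * g * y * S q * h * srun q.+1 s) * (srun r s.-1)^-1.
  rewrite (@band_run r q.+1 s) //; try lia.
  rewrite srunSr //.
  move: (srun q.+1 s) (srun r s.-1) => a b.
  by rewrite !mulgA (mulg3_congr _ E).
by apply/reachMr/reachMl/reach_run => //; [apply: nonneg_srunV|lia].
Qed.

(** A band starting at [p] brings no [S p.-1]. If [k] has none either, it commutes with the band,
    which joins [g]; otherwise [reach_run] applies. *)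
Lemma reach_touch m p s x : 0 < p -> p < s -> s <= m -> m < N -> reach m p x ->
  reach m p (x * A p s) \/ reach m s (x * A p s).
Proof.
move=> p0 ps sm mN [z [g [k [hz hg hk ->]]]].
have [hk'|hk'] : gen 1 p.-1 k \/ [/\ 1 < p & ~ gen 1 p.-1 k].
(* For [p = 1] the letter [S p.-1] is the default value 1, so [k] is trivial. *)
- case: (ltnP 1 p) => p1; last first.
    left; rewrite (gen_geq _ (nonneg_sub hk)) //; exact: gen1.
  by case: (boolp.EM (gen 1 p.-1 k)) => h; [left|right].
- left; exists z, (g * A p s), k; split => //.
    by apply: genM hg _; apply: gen_sub (band_gen ps) => //; lia.
  have c : commute k (A p s).
    by apply: gen_gen_comm hk' (band_gen ps); lia.
  by move: (A p s) c => y c; rewrite -!mulgA c.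
- right; case: hk' => p1 nk; case: hk nk => [//|y h hy hh _].
  case: p p0 ps p1 hg hy hh => // q p0 ps p1 hg hy hh.
  have -> : z * S m * g * (y * S q * h) * A q.+1 s =
    z * (S m * g * y * S q * h * srun q.+1 s) * (srun q.+1 s.-1)^-1.
    by rewrite band_srun // !mulgA.
  by apply/reachMr/reachMl/reach_run => //; exact: nonneg_srunV.
Qed.

(** Unlike in [reach_run], a run [srun q m] has to survive on the right of [S m]. If [x] contains
    [S q], its first [S q] drives [S m] to the right and the final one becomes [A q m], which begins
    with such a run; otherwise [x] commutes with [S m] and [g]. *)
Lemma reach_last_run m q g x : 0 < q -> q.+1 < m -> m < N ->
    gen q.+1 m g -> nonneg q.+1 x ->
  exists z h, [/\ nonneg m.+1 z, gen q m.-1 h &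
     S m * g * x * S q * srun q.+1 m = z * S m * srun q m * h].
Proof.
move=> q0 qm mN hg hx.
have [h hh Eh] : exists2 h, gen q m.-1 h & g * srun q m = srun q m * h.
  by apply: gen_run_swap => //; lia.
have cx y : gen 1 q y -> S m * g * y * S q * srun q.+1 m = y * S m * srun q m *
  h.
  move=> hy; have c1 : commute y g by apply: gen_gen_comm hy hg.
  have c2 : commute y (S m) by apply: (gen_gen_comm _ hy (@genS m m.+1 m _));
    lia.
  rewrite -mulgA -srunSl; last by lia.
  by rewrite -[S m * g * y]mulgA -c1 mulgA -c2 -2!mulgA Eh !mulgA.
have sy y : gen 1 q y -> nonneg m.+1 y.
  by move=> hy; apply: nonneg_gen; apply: gen_sub hy => /=; lia.
case: hx => [y hy|y k hy hk]; first by exists y, h; split => //;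
  [apply: sy|apply: cx].
have hk' : nonneg m (k ^ srun q.+1 m) by apply: nonneg_run => //; lia.
have [z hz Ez] : exists2 z, nonneg m.+1 z &
    S m * (srun q m * h * k ^ srun q.+1 m) = z * S m.
  apply: nonneg_swap => //; apply: nonnegM hk'.
  by apply: nonneg_gen_run => //; lia.
exists (y * z), (srun q m.-1)^-1; split.
- exact: nonnegM (sy _ hy) hz.
- exact/genV/gen_srun.
have -> : S m * g * (y * S q * k) * S q * srun q.+1 m =
  S m * g * y * S q * srun q.+1 m * k ^ srun q.+1 m * S q ^ srun q.+1 m.
  by rewrite -[LHS]mulgA -[RHS]mulgA -conjMg [in RHS]conjgE -!mulgA mulVKg
    !mulgA.
rewrite cx // -bandE //; try lia.
rewrite band_srun; last by lia.
by rewrite -[y * z * _]mulgA -Ez !mulgA.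
Qed.

(** [S m] is the last letter of [delta N m.+1], with which it cancels once [x] has been carried
    across. *)
Lemma delta_swap m x : S m * x * (delta N m.+1)^-1 = (srun 1 m)^-1 * phi m.+1 x.
Proof.
case: m => [|m].
  by rewrite /phi delta_srun srun_geq // srun_geq // (@sigma_oob 0) // invg1
    !mulg1 !mul1g.
by rewrite /phi delta_srun srunSr //; move: (srun 1 m.+1) => a;
  rewrite !mulgA mulVg mul1g.
Qed.

Lemma reach_runMr m a p g : 0 < a -> a <= m -> gen p m g ->
  reach m p (srun a m.+1 * g).
Proof.
move=> a0 am hg; exists (srun a m), g, 1; split => //.
- exact/nonneg_gen/gen_srun_sub.
- exact: nonneg1.
by rewrite srunSr // mulg1.
Qed.

(** The last [S m] is spent on the inverse of [delta]. In return, [phi m.+1] turns a run ending with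
    [S m.-1] into one ending with [S m]; that run comes from [A r m] if [p = m], and from
    [reach_last_run] otherwise. *)
Lemma reach_last m p r x : 0 < r -> r < p -> p <= m -> m < N -> reach m p x ->
  reach m r.+1 (x * A r m * (delta N m.+1)^-1).
Proof.
move=> r0 + pm mN; move: pm; rewrite leq_eqVlt => /predU1P[->|pm] rp hx.
  have [z hz ->] := reach_top mN hx.
  have -> : z * S m * A r m * (delta N m.+1)^-1 =
      z * (srun 1 m)^-1 * phi m.+1 (A r m).
    by rewrite -[RHS]mulgA -delta_swap; move: (A r m) => y; rewrite !mulgA.
  apply: reachMl.
    by apply: nonnegM hz _; apply: (@nonneg_srunV 1 m.+1).
  rewrite phi_band //; try lia.
  rewrite band_srun; last by lia.
  by apply: reach_runMr => //; apply/genV/gen_srun.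
case: p rp pm hx => // q rp pm [z [g [k [hz hg hk ->]]]].
have [y [h [hy hh E]]] : exists z h, [/\ nonneg m.+1 z, gen q m.-1 h &
     S m * g * (k * srun r q) * S q * srun q.+1 m = z * S m * srun q m * h].
  apply: reach_last_run => //; first by lia.
  by apply: nonnegM hk _; apply/nonneg_gen/gen_srun_sub.
have -> : z * S m * g * k * A r m * (delta N m.+1)^-1 =
    z * y * (srun 1 m)^-1 * phi m.+1 (srun q m * h * (srun r m.-1)^-1).
  rewrite -[RHS]mulgA -delta_swap (@band_run r q.+1 m) ?srunSr //; try lia.
  move: (srun q.+1 m) (srun q m) (srun r m.-1) (srun r q) E => a b c d E.
  rewrite !mulgA -[z * y * _]mulgA -[z * (y * _) * _]mulgA -[z * (y * _ * _) *
    _]mulgA.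
  by rewrite -E !mulgA.
apply: reachMl.
  by apply: nonnegM (nonnegM hz hy) _; apply: (@nonneg_srunV 1 m.+1).
rewrite !phiM phiV !phi_srun //; try lia.
rewrite prednK; last by lia.
rewrite -mulgA; apply: reach_runMr => //; first by lia.
apply: genM; last by apply/genV/gen_srun.
have: gen q.+1 m.-1.+1 (phi m.+1 h) by apply: phi_gen => //; lia.
by apply: gen_sub; lia.
Qed.

Lemma reach_shift_out m x : 0 < m -> m < N -> reach m m x ->
  nonneg m.+1 (x * (delta N m.+1)^-1).
Proof.
move=> m0 mN /(reach_top mN)[z hz ->].
rewrite delta_srun srunSr // invgM mulgA mulgK.
by apply: nonnegM hz _; apply: (@nonneg_srunV 1 m.+1).
Qed.

Lemma reach1_delta m z : 0 < m -> nonneg m.+1 z -> reach m 1 (delta N m.+1 * z).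
Proof.
move=> m0 hz; rewrite delta_srun srunSr // -mulgA; apply: reachMl.
  exact/nonneg_gen/gen_srun.
case: (nonneg_last hz) => [hz'|[y [g [hy hg ->]]]].
  by exists 1, z, 1; rewrite mul1g mulg1; split => //; apply: nonneg1.
exists (S m * y), g, 1; split => //; try exact: nonneg1.
  by apply: nonnegM hy; apply: (@nonneg_sigma m.+1).
by rewrite mulg1 !mulgA.
Qed.

Lemma phi_reach m p x : 0 < p -> p <= m -> m.+1 < N -> reach m p x ->
  reach m.+1 p.+1 (phi m.+2 x).
Proof.
move=> p0 pm mN [z [g [k [hz hg hk ->]]]].
exists (phi m.+2 z), (phi m.+2 g), (phi m.+2 k); split.
- exact: phi_nonneg.
- by apply: phi_gen.
- by apply: phi_nonneg => //; lia.
- by rewrite !phiM phi_sigma //; lia.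
Qed.

(** * The dual braid monoid and exponent sums *)

Lemma dual_phi n x : n <= N -> dual n x -> dual n (phi n x).
Proof.
move=> nN; elim=> [|p q p0 pq qn|y z _ hy _ hz]; first by rewrite phi1;
  apply: Dual1.
  move: qn; rewrite leq_eqVlt => /predU1P[qn|qn].
    by rewrite qn in pq *; rewrite phi_band_top //; apply: DualBand.
  by rewrite phi_band //; apply: DualBand.
by rewrite phiM; apply: DualM.
Qed.

Lemma dual_sub m n x : m <= n -> dual m x -> dual n x.
Proof.
move=> mn; elim=> [|p q p0 pq qm|y z _ hy _ hz]; first exact: Dual1.
  by apply: DualBand => //; apply: leq_trans mn.
exact: DualM.
Qed.

Lemma dual_gen m x : dual m x -> gen 1 m x.
Proof.
elim=> [|p q p0 pq qm|y z _ hy _ hz]; first exact: gen1.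
  exact: gen_sub (band_gen pq).
exact: genM.
Qed.

Lemma dual_nonneg m x : dual m x -> nonneg m x.
Proof.
elim=> [|p q p0 pq qm|y z _ hy _ hz]; first exact: nonneg1.
  exact: band_nonneg.
exact: nonnegM.
Qed.

(** [DualM] multiplies arbitrary elements; ladders need an induction that appends one letter at a
    time on the right. *)
Lemma dual_rind m (P : braid N -> Prop) : P 1 ->
    (forall x r s, dual m x -> P x -> 0 < r -> r < s -> s <= m ->
      P (x * A r s)) ->
  forall x, dual m x -> P x.
Proof.
move=> P1 PM x hx.
suff: dual m (1 * x) /\ P (1 * x) by rewrite mul1g => -[].
move: (1) (Dual1 N m) P1 => y hy Py.
elim: hx y hy Py => [|p q p0 pq qm|u v _ hu _ hv] y hy Py.
- by rewrite mulg1.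
- by split; [apply: DualM => //; apply: DualBand|apply: PM].
- by rewrite mulgA; have [] := hu y hy Py; apply: hv.
Qed.

Lemma dual_last m x : dual m x ->
  x = 1 \/ exists z t u, [/\ dual m z, 0 < t, t < u, u <= m & x = z * A t u].
Proof.
move: x; apply: dual_rind => [|x r s hx _ r0 rs sm]; first by left.
by right; exists x, r, s.
Qed.

(* The exponent sum a - b is an invariant; it shows that no band is invertible
   in the dual monoid. *)
Definition has_counts x a b : Prop :=
  exists w : word N, [/\ braid_of w = x, count (fun l : letter N => l.2) w = a
                       & count (fun l : letter N => ~~ l.2) w = b].

Lemma has_counts_uniq x a b a' b' :
  has_counts x a b -> has_counts x a' b' -> a + b' = a' + b.
Proof.
move=> [w [<- <- <-]] [w' [/braid_ofP E <- <-]].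
elim: E => {w w'} [w|v w _|u v w _ + _|u v u' v' _ + _|i c|i j _|i j _] //=.
- by lia.
- by rewrite !count_cat; lia.
- by case: c.
Qed.

Lemma has_counts_ex x : exists a b, has_counts x a b.
Proof. by do 2!eexists; exists (repr x); split; first exact: braid_of_repr. Qed.

Lemma has_countsM x y a b a' b' :
  has_counts x a b -> has_counts y a' b' ->
    has_counts (x * y) (a + a') (b + b').
Proof.
by move=> [v [<- <- <-]] [w [<- <- <-]]; exists (v ++ w);
  rewrite mul_braid_of !count_cat.
Qed.

Lemma has_countsV x a b : has_counts x a b -> has_counts x^-1 b a.
Proof.
move=> [w [<- <- <-]]; exists (winv w); split.
- by rewrite braid_of_inv.
- by rewrite /winv count_rev count_map.
- by rewrite /winv count_rev count_map; apply: eq_count => l /=; rewrite negbK.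
Qed.

Lemma has_counts_band p q : 0 < p -> p < q -> q <= N ->
  exists a, has_counts (A p q) a.+1 a.
Proof.
move=> p0 pq qN; rewrite band_def.
have [a [b h]] := has_counts_ex (srun p q.-1).
have h1 : has_counts (S q.-1) 1 0.
  have hq : 0 < q.-1 < N by lia.
  by rewrite (sigma_in hq); eexists; split.
by exists (a + b); have := has_countsM (has_countsM h h1) (has_countsV h); 
  rewrite addn1 addn0 addSn [b + a]addnC.
Qed.

Lemma dual_counts m x : m <= N -> dual m x -> exists a d,
  has_counts x (a + d) a.
Proof.
move=> mN; elim=> [|p q p0 pq qm|y z _ [a [d hy]] _ [a' [d' hz]]].
- by exists 0, 0, [::].
- have [||| a ha] := @has_counts_band p q => //; first by apply: leq_trans mN.
  by exists a, 1%N; rewrite addn1.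
- by exists (a + a'), (d + d'); rewrite addnACA; apply: has_countsM.
Qed.

Lemma dual_mul_band_neq1 m z p q : m <= N -> dual m z ->
  0 < p -> p < q -> q <= m -> z * A p q <> 1.
Proof.
move=> mN hz p0 pq qm E; have [a [d hz']] := dual_counts mN hz.
have [||| b hb] := @has_counts_band p q => //; first by apply: leq_trans mN.
have h1 : has_counts 1 0 0 by exists [::].
by have := has_countsM hz' hb; rewrite E => /has_counts_uniq-/(_ _ _ h1); lia.
Qed.

Lemma dual_mul_eq1 m x y : m <= N -> dual m x -> dual m y -> x * y = 1 -> x = 1.
Proof.
move=> mN hx /dual_last[->|[z [t [u [hz t0 tu um ->]]]]];
  first by rewrite mulg1.
by rewrite mulgA => /(dual_mul_band_neq1 mN (DualM hx hz) t0 tu um).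
Qed.

(** * Right divisors and ladders *)

Lemma rd_mulr n x y : dual n x -> right_divides n y (x * y).
Proof. by move=> hx; exists x. Qed.

Lemma rd_phi n x y : n <= N -> right_divides n x y ->
  right_divides n (phi n x) (phi n y).
Proof.
by move=> nN [w hw ->]; exists (phi n w); [apply: dual_phi|rewrite phiM].
Qed.

Lemma rd_commute n x y z z' : right_divides n x y -> dual n z' ->
  x * z = z' * x -> right_divides n x (y * z).
Proof.
move=> [w hw ->] hz E; exists (w * z'); first exact: DualM.
by rewrite -!mulgA E.
Qed.

Definition in_span m e t u : Prop :=
  0 < t /\ (t < u /\ u <= e \/ t <= e /\ u = m.+1).

(** [A t u * A r s] is always a band times [A t u]: by commutation if the index pairs are separated
    or nested, by [band_conj] or [band_conj'] if they share [r]. *)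
Lemma in_span_rd m e t u r s y : m < N -> e <= r -> r < s -> s <= m ->
    in_span m e t u -> right_divides m.+1 (A t u) y ->
  right_divides m.+1 (A t u) (y * A r s).
Proof.
move=> mN er rs sm [t0 tu] h.
have d p q : 0 < p -> p < q -> q <= m.+1 ->
  dual m.+1 (A p q) by apply: DualBand.
case: tu => [[tu ue]|[te eu]].
  case: (ltnP u r) => ur.
    apply: (rd_commute h (d r s _ rs _)); try lia.
    exact: band_comm_out.
  have <- : u = r by lia.
  apply: (rd_commute h (d t s _ _ _)); try lia.
  by apply: band_conj => //; lia.
rewrite {u}eu in h *; case: (ltnP t r) => tr.
  apply: (rd_commute h (d r s _ rs _)); try lia.
  by apply/esym/band_comm_nest.
have <- : t = r by lia.
apply: (rd_commute h (d s m.+1 _ _ _)); try lia.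
by apply: band_conj'; lia.
Qed.

(* The index e is the barrier reached so far by the ladder: at e = m there is
   room to absorb a factor delta_{m+1}^-1, and below m the right divisor
   A t u is one that a splitting forbids. *)
Definition state m x y : Prop := exists e t u,
  [/\ 0 < e <= m, reach m e x, in_span m e t u & right_divides m.+1 (A t u) y].

(** A letter that ends below the barrier, or moves it to [s], becomes the recorded divisor. Any
    other letter starts at or above [e], and [in_span_rd] keeps the old divisor. *)
Lemma state_band m r s x y : m < N -> 0 < r -> r < s -> s <= m -> dual m.+1 y ->
  state m x y -> state m (x * A r s) (y * A r s).
Proof.
move=> mN r0 rs sm hy [e [t [u [/andP[e0 em] he tu hd]]]].
have new i : 0 < i <= m -> s <= i -> reach m i (x * A r s) ->
    state m (x * A r s) (y * A r s).
  by move=> im si hi; exists i, r, s; split => //; [split;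
    [|left]|exact: rd_mulr].
have old : e <= r -> reach m e (x * A r s) -> state m (x * A r s) (y * A r s).
  move=> er hi; exists e, t, u; split => //; first by rewrite e0.
  exact: (in_span_rd mN er rs sm tu hd).
case: (leqP s e) => se; first by apply: (new e); rewrite ?e0 //;
  apply: reach_low.
case: (ltngtP r e) => re.
- by apply: (new s) => //; [lia|apply: reach_cross he].
- by apply: old; [apply: ltnW|apply: reach_high].
- rewrite re in rs *; rewrite re in new old.
  case: (reach_touch e0 se sm mN he) => h; [exact: old|].
  by apply: (new s) => //; lia.
Qed.

(** The invariant carried down two splittings, for $x=\phi_n(v_{k+1})$ and $y=\phi_n(y_{k+1})$; the
    ladder starts at [p]. *)
Definition guarded m x y : Prop := exists p,
  [/\ 0 < p <= m, reach m p x & right_divides m.+1 (A p m.+1) y].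

(* Triviality of the B_{n-1}-tail, tested on the generators only. *)
Definition no_low_divisor n x : Prop := forall t u,
  0 < t -> t < u -> u < n -> ~ right_divides n (A t u) x.

Lemma guarded_state m x y : guarded m x y -> state m x y.
Proof.
move=> [p [/andP[p0 pm] hx hy]]; exists p, p, m.+1; split => //;
  first by rewrite p0.
by split => //; right.
Qed.

Lemma state_dual m x y z : m < N -> dual m.+1 y -> state m x y -> dual m z ->
  state m (x * z) (y * z).
Proof.
move=> mN hy hxy; move: z; apply: dual_rind => [|z r s hz IH r0 rs sm].
  by rewrite !mulg1.
rewrite (mulgA x) (mulgA y); apply: state_band => //; apply: DualM => //.
exact: dual_sub hz.
Qed.

(** Here [g] is $b_k^{-1}$ and [z] is $c_k$. Right divisors [A t u] of [y * z] with [u < m], or with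
    [t < m] and [u = m.+1], are forbidden, as [phi] sends them to bands of $B_m$. Hence the last
    letter of [z] ends at [m]. *)
Lemma guarded_step m x y g z : 1 < m -> m < N -> dual m.+1 y -> guarded m x y ->
    gen 1 m g -> dual m z -> no_low_divisor m.+1 (phi m.+1 (y * z)) ->
  guarded m (phi m.+1 (g * x * z)) (phi m.+1 (y * z)).
Proof.
move=> m1 mN hy hxy hg hz hn.
have low t u : 0 < t -> t < u -> u < m -> ~ right_divides m.+1 (A t u) (y * z).
  move=> t0 tu um /(rd_phi mN); rewrite phi_band //; last by lia.
  by apply: hn; lia.
have top t : 0 < t -> t < m -> ~ right_divides m.+1 (A t m.+1) (y * z).
  move=> t0 tm /(rd_phi mN); rewrite phi_band_top //; last by lia.
  by apply: hn; lia.
have phig w : phi m.+1 (g * w) = delta N m.+1 * (g * (w * (delta N m.+1)^-1)).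
  by rewrite /phi -!mulgA.
have hdg : nonneg m.+1 (delta N m.+1 * g).
  apply: nonnegM; last exact: nonneg_gen.
  rewrite delta_srun srunSr; last by lia.
  apply: nonnegM; last exact: (@nonneg_sigma m.+1).
  exact/nonneg_gen/gen_srun.
move: (dual_last hz) => [z1|[w [r [s [hw r0 rs sm Ez]]]]].
  (* With no letter in [z], only [p = m] is allowed; since [phi] sends [A m m.+1] to [A 1 m.+1], the
     new barrier is 1. *)
  rewrite z1 !mulg1 in top *; case: hxy => p [/andP[p0 pm] hx hd].
  case: (ltnP p m) => pm'; first by case: (top p).
  have pE : p = m by lia.
  rewrite pE in hx hd; exists 1%N; split; first by lia.
    rewrite phig; apply: reach1_delta; first by lia.
    apply: nonnegM; first exact: nonneg_gen.
    by apply: reach_shift_out => //; lia.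
  by move: (rd_phi mN hd); rewrite phi_band_top //; lia.
have sE : s = m.
  case: (ltngtP s m) => // sm'; last by lia.
  case: (low r s) => //; rewrite Ez mulgA; apply: rd_mulr.
  by apply: DualM hy _; apply: dual_sub hw.
rewrite {s}sE in rs sm Ez.
have dw : dual m.+1 (y * w) by apply: DualM hy _; apply: dual_sub hw.
have hd : right_divides m.+1 (A r m) (y * z) by rewrite Ez mulgA;
  apply: rd_mulr.
exists r.+1; split; first by lia.
  have [e [t [u [/andP[e0 em] he tu htu]]]] :=
    state_dual mN hy (guarded_state hxy) hw.
  (* If [e <= r], the recorded divisor survives the last letter [A r m], although it is a forbidden
     band. *)
  case: (ltnP r e) => re; last first.
    have htu' : right_divides m.+1 (A t u) (y * z).
      by rewrite Ez mulgA; apply: (in_span_rd mN re rs (leqnn m) tu htu).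
    case: tu => t0 [[tu ue]|[te uE]].
      by case: (low t u) => //; lia.
    by rewrite uE in htu'; case: (top t) => //; lia.
  rewrite Ez -mulgA phig.
  rewrite mulgA; apply: reachMl hdg _.
  by rewrite (mulgA x w); apply: reach_last he.
by have := rd_phi mN hd; rewrite phi_band.
Qed.

(** The start when the second splitting is longer: the other partial product is still 1. The last
    letter of [y] has to end at [m.+1] and supplies the barrier. *)
Lemma guarded_refl m y : m < N -> dual m.+1 y -> y <> 1 ->
  no_low_divisor m.+1 y -> guarded m y y.
Proof.
move=> mN /dual_last[//|[z [t [u [hz t0 tu um ->]]]]] _ hn.
have uE : u = m.+1.
  case: (ltngtP u m.+1) => // h; last by lia.
  by case: (hn t u t0 tu h); apply: rd_mulr.
rewrite {u}uE in tu um hn *; exists t; split; [lia| |exact: rd_mulr].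
apply: reachMl; first exact: dual_nonneg.
by rewrite band_srun //; apply: reach_runMr => //; apply/genV/gen_srun.
Qed.

Lemma phi_guarded m x y z : m.+1 < N -> dual m.+2 z -> guarded m x y ->
  guarded m.+1 (phi m.+2 x) (phi m.+2 (z * y)).
Proof.
move=> mN hz [p [/andP[p0 pm] hx [w hw ->]]]; exists p.+1; split; first by lia.
  exact: phi_reach.
rewrite -(phi_band mN) //; apply: rd_phi => //; rewrite mulgA; apply: rd_mulr.
by apply: DualM hz _; apply: dual_sub hw.
Qed.

(** [phi] raises both indices of a low band by one, so the tail condition on a partial product
    passes to its last factor, one rank lower. *)
Lemma no_low_divisor_entry m x y : m.+1 < N -> dual m.+2 x ->
  no_low_divisor m.+2 (phi m.+2 (x * y)) -> no_low_divisor m.+1 y.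
Proof.
move=> mN hx hn t u t0 tu um [w hw Ey]; apply: (hn t.+1 u.+1) => //.
rewrite -(phi_band mN) //; last by lia.
apply: rd_phi => //; rewrite Ey mulgA; apply: rd_mulr.
by apply: DualM hx _; apply: dual_sub hw.
Qed.

Lemma no_low_divisor_dual m x y : dual m x -> no_low_divisor m.+1 y ->
  right_divides m.+1 x y -> x = 1.
Proof.
move=> /dual_last[//|[z [t [u [hz t0 tu um ->]]]]] hn [w hw Ey].
case: (hn t u) => //; rewrite Ey mulgA; apply: rd_mulr.
by apply: DualM hw _; apply: dual_sub hz.
Qed.

(** * Splittings as iterated products *)

(** Horner form of the product in [is_splitting]; the start value lets two splittings be resumed
    after a common prefix. *)
Definition assemble n x (s : seq (braid N)) : braid N :=
  foldl (fun y z => phi n y * z) x s.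

Lemma assemble_prod n (s : seq (braid N)) :
  \big[*%g/1]_(0 <= i < size s) iter (size s - i.+1) (phi n) (nth 1 s i) =
  assemble n 1 s.
Proof.
elim/last_ind: s => [|s z IH]; first by rewrite big_geq.
rewrite /assemble foldl_rcons -/(assemble n 1 s) -IH size_rcons.
rewrite big_nat_recr // subnn nth_rcons ltnn eqxx (big_morph _ (@phiM n) (@phi1
  n)).
congr (_ * _); apply: eq_big_nat => i /= hi.
by rewrite nth_rcons hi subSS -iterS; congr (iter _ _ _); lia.
Qed.

Lemma assemble_dual m x (s : seq (braid N)) : m < N -> dual m.+1 x -> (forall y,
  y \in s -> dual m y) ->
  dual m.+1 (assemble m.+1 x s).
Proof.
move=> mN; elim: s x => //= z s IH x hx hs; apply: IH => [|y ys].
  apply: DualM; first exact: dual_phi.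
  by apply: (@dual_sub m) => //; apply: hs; rewrite mem_head.
by apply: hs; rewrite inE ys orbT.
Qed.

Lemma assemble_neq1 m (s : seq (braid N)) : m < N -> (forall y, y \in s ->
  dual m y) ->
  head 1 s <> 1 -> assemble m.+1 1 s <> 1.
Proof.
move=> mN; elim/last_ind: s => [//|s z IH] hs hh E.
have hs' y : y \in s -> dual m y by move=> ys; apply: hs;
  rewrite mem_rcons inE ys orbT.
have hz : dual m z by apply: hs; rewrite mem_rcons mem_head.
have : phi m.+1 (assemble m.+1 1 s) = 1.
  move: E; rewrite /assemble foldl_rcons; apply: (@dual_mul_eq1 m.+1) => //.
    by apply: dual_phi => //; apply: assemble_dual => //; apply: Dual1.
  exact: dual_sub hz.
case: s {hs} IH hh E hs' => [|h s] IH hh E hs' E1.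
  by move: E; rewrite /assemble /= phi1 mul1g.
by apply: IH => //; apply: (conjg_inj (delta N m.+1)^-1);
  rewrite -phiE E1 conj1g.
Qed.

(** The tail condition of index [k] becomes one on the prefix of length [j = size s - k]. *)
Definition split_seq m x (s : seq (braid N)) : Prop :=
  [/\ 0 < size s, (forall y, y \in s -> dual m y), x = assemble m.+1 1 s
    & forall j, j < size s ->
        no_low_divisor m.+1 (phi m.+1 (assemble m.+1 1 (take j s)))].

Lemma no_low_divisor1 m : m <= N -> no_low_divisor m (1 : braid N).
Proof.
move=> mN t u t0 tu um [z hz /esym]; apply: dual_mul_band_neq1 hz _ _ _ => //.
exact: ltnW.
Qed.

Lemma is_splittingP m x (s : seq (braid N)) : m < N -> is_splitting m.+1 x s ->
  split_seq m x s /\ (1 < size s -> head 1 s <> 1).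
Proof.
move=> mN [[-> ->]|[x1 hs hh Ex ht]].
  split=> //; split => //.
  - by move=> y; rewrite inE => /eqP->; apply: Dual1.
  - by rewrite /assemble /= phi1 mulg1.
  - by case=> // _; rewrite /assemble /= phi1; apply: no_low_divisor1.
split=> //; split => //; first by case: s hh {hs Ex ht}.
  by rewrite Ex assemble_prod.
move=> j js; have [|_ _] := ht (size s - j); first by lia.
rewrite subKn; last exact: ltnW.
set y := bigop _ _ _; have -> : y = phi m.+1 (assemble m.+1 1 (take j s)).
  rewrite -assemble_prod (big_morph _ (@phiM m.+1) (@phi1 m.+1)) size_takel
    1?ltnW //.
  apply: eq_big_nat => i /= hi; rewrite nth_take // -iterS; congr (iter _ _ _);
    lia.
(* A band dividing the product would divide its tail 1, against the exponent sum. *)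
move=> {y} hy t u t0 tu um hd.
have [z hz] := hy _ (DualBand N t0 tu um) hd.
by move/esym; apply: dual_mul_band_neq1 hz _ _ _ => //; apply: ltnW.
Qed.

(** * Comparison of two splittings *)

Lemma guarded_loop m (s t : seq (braid N)) x y : 1 < m -> m < N ->
  size s = size t ->
    (forall z, z \in s -> dual m z) -> (forall z, z \in t -> dual m z) ->
    dual m.+1 y -> guarded m (phi m.+1 (x^-1 * y)) (phi m.+1 y) ->
    (forall j, 0 < j <= size t ->
       no_low_divisor m.+1 (phi m.+1 (assemble m.+1 y (take j t)))) ->
  guarded m (phi m.+1 ((assemble m.+1 x s)^-1 * assemble m.+1 y t))
            (phi m.+1 (assemble m.+1 y t)).
Proof.
move=> m1 mN; elim: s t x y => [|b s IH] [|c t] //= x y [st] hs ht hy hxy hn.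
have hb : dual m b by apply: hs; rewrite mem_head.
have hc : dual m c by apply: ht; rewrite mem_head.
apply: IH => //.
- by move=> z zs; apply: hs; rewrite inE zs orbT.
- by move=> z zt; apply: ht; rewrite inE zt orbT.
- by apply: DualM; [apply: dual_phi|apply: dual_sub hc].
- have -> : (phi m.+1 x * b)^-1 * (phi m.+1 y * c) = b^-1 * phi m.+1 (x^-1 * y)
  * c.
    by rewrite phiM phiV invgM !mulgA.
  apply: guarded_step => //; first exact: dual_phi.
    exact/genV/dual_gen.
  by have := hn 1%N isT; rewrite /= take0.
- by move=> j /andP[_ hj]; apply: (hn j.+1).
Qed.

(* Here b and c are the last entries of the splittings of x and y. *)
Definition guarded_diff m x y : Prop := exists v w (b c : braid N),
  [/\ guarded m v w, dual m b, dual m c, x^-1 * y = b^-1 * v * c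
    & right_divides m.+1 b x /\ (y = w * c /\ dual m.+1 w)].

(** The last entries are kept apart: the tail conditions concern proper prefixes, so [guarded_step]
    stops before them. *)
Lemma guarded_diff_loop m (s t : seq (braid N)) x y : 1 < m -> m < N ->
  size s = size t -> 0 < size t ->
    (forall z, z \in s -> dual m z) -> (forall z, z \in t -> dual m z) ->
    dual m.+1 x -> dual m.+1 y ->
      guarded m (phi m.+1 (x^-1 * y)) (phi m.+1 y) ->
    (forall j, 0 < j < size t ->
       no_low_divisor m.+1 (phi m.+1 (assemble m.+1 y (take j t)))) ->
  guarded_diff m (assemble m.+1 x s) (assemble m.+1 y t).
Proof.
move=> m1 mN; case: (lastP s) => [<- //|{}s b]; case: (lastP t) => [//|{}t c].
rewrite !size_rcons => -[st] _ hs ht hx hy hxy hn.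
have hb : dual m b by apply: hs; rewrite mem_rcons mem_head.
have hc : dual m c by apply: ht; rewrite mem_rcons mem_head.
have hs' z : z \in s -> dual m z by move=> zs; apply: hs;
  rewrite mem_rcons inE zs orbT.
have ht' z : z \in t -> dual m z by move=> zs; apply: ht;
  rewrite mem_rcons inE zs orbT.
rewrite /assemble !foldl_rcons -/(assemble m.+1 x s) -/(assemble m.+1 y t).
exists (phi m.+1 ((assemble m.+1 x s)^-1 * assemble m.+1 y t)),
  (phi m.+1 (assemble m.+1 y t)), b, c; split => //.
- apply: guarded_loop => // j hj; have := hn j.
  by rewrite -cats1 takel_cat; [apply; lia|lia].
- by rewrite phiM phiV invgM !mulgA.
- split; first by apply: rd_mulr; apply: dual_phi => //; apply: assemble_dual.
  by split=> //; apply: dual_phi => //; apply: assemble_dual.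
Qed.

(** The assumption on [lt] is the induction hypothesis for entries. The second outcome is a first
    difference at the last entries, where no tail condition is available. *)
Lemma shortlex_guarded m x y (s t : seq (braid N)) (lt : braid N -> braid N ->
  Prop) :
    m.+2 < N ->
    (forall b c : braid N, lt b c -> no_low_divisor m.+2 b ->
      no_low_divisor m.+2 c ->
       guarded m.+1 (b^-1 * c) c) ->
    is_splitting m.+3 x s -> is_splitting m.+3 y t -> shortlex lt s t ->
  guarded_diff m.+2 x y \/
  exists z (b c : braid N), [/\ dual m.+2 b, dual m.+2 c, b <> c, lt b c &
    dual m.+3 z /\ (x = z * b /\ y = z * c)].
Proof.
move=> mN hlt /(is_splittingP mN)[[s0 hs Ex ns] _] /(is_splittingP mN)[[t0 ht Ey
  nt] tt].
have ds (u : seq (braid N)) : (forall z, z \in u -> dual m.+2 z) ->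
    dual m.+3 (assemble m.+3 1 u).
  by move=> hu; apply: assemble_dual => //; apply: Dual1.
case=> [st|[st [i [hi hj hne hij]]]].
  (* The sequences are aligned at their right ends; the first [d] entries of [t] face the partial
     product 1. *)
  left; set d := size t - size s.
  have Et : take d t ++ drop d t = t by rewrite cat_take_drop.
  have h1 z : z \in take d t -> dual m.+2 z by move=> /mem_take; apply: ht.
  have h2 z : z \in drop d t -> dual m.+2 z by move=> /mem_drop; apply: ht.
  have szd : size s = size (drop d t) by rewrite size_drop /d; lia.
  rewrite Ex Ey -Et /assemble foldl_cat -/(assemble m.+3 1 (take d t)).
  apply: guarded_diff_loop => //; try by rewrite -szd.
  - exact: Dual1.
  - exact: ds.
  - rewrite invg1 mul1g; apply: guarded_refl => //.
    + by apply: dual_phi => //; apply: ds.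
    + rewrite phiE => E; have := @assemble_neq1 m.+2 (take d t) mN h1.
      case; last by apply: (conjg_inj (delta N m.+3)^-1); rewrite E conj1g.
      have -> : head 1 (take d t) = head 1 t.
        have : 0 < d by rewrite /d; lia.
        by case: (t) (d) => [|c t'] [|d'].
      by apply: tt; lia.
    + by apply: nt; rewrite /d; lia.
  - move=> j hj; have := nt (d + j).
    rewrite takeD /assemble foldl_cat; apply.
    by rewrite -szd /d in hj *; lia.
have Et : t = take i t ++ nth 1 t i :: drop i.+1 t.
  by rewrite -drop_nth ?cat_take_drop // -st.
have Es : s = take i t ++ nth 1 s i :: drop i.+1 s.
  rewrite -drop_nth // -[LHS](cat_take_drop i); congr (_ ++ _).
  apply: (@eq_from_nth _ 1) => [|j]; first by rewrite !size_take st.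
  by rewrite size_takel => [ji|]; [rewrite !nth_take ?hj|exact: ltnW].
have hb : dual m.+2 (nth 1 s i) by apply/hs/mem_nth.
have hc : dual m.+2 (nth 1 t i) by apply/ht/mem_nth; rewrite -st.
have hti z : z \in take i t -> dual m.+2 z by move=> /mem_take; apply: ht.
set z := phi m.+3 (assemble m.+3 1 (take i t)).
have hz : dual m.+3 z by apply: dual_phi => //; apply: ds.
have Ex' : x = assemble m.+3 (z * nth 1 s i) (drop i.+1 s).
  by rewrite Ex {1}Es /assemble foldl_cat.
have Ey' : y = assemble m.+3 (z * nth 1 t i) (drop i.+1 t).
  by rewrite Ey {1}Et /assemble foldl_cat.
case: (ltnP i.+1 (size s)) => is_; last first.
  right; exists z, (nth 1 s i), (nth 1 t i); split=> //; split=> //.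
  by rewrite Ex' Ey' !drop_oversize // -st.
left; have nt1 j : i < j < size t ->
    no_low_divisor m.+3
      (phi m.+3 (assemble m.+3 (z * nth 1 t i) (take (j - i.+1) (drop i.+1
        t)))).
  move=> /andP[ij jt]; have := nt j jt; rewrite [in take j t]Et take_cat.
  rewrite size_takel; last by lia.
  rewrite ltnNge ltnW //= /assemble foldl_cat.
  by have -> : j - i = (j - i.+1).+1 by lia.
have ns1 : no_low_divisor m.+3 (phi m.+3 (z * nth 1 s i)).
  have := ns i.+1 is_; rewrite {1}Es take_cat size_takel; last by lia.
  by rewrite ltnNge leqnSn /= subSnn /= take0 /assemble foldl_cat.
have nt2 : no_low_divisor m.+3 (phi m.+3 (z * nth 1 t i)).
  by have := nt1 i.+1; rewrite subnn take0; apply; rewrite -st leqnn.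
rewrite Ex' Ey'; apply: (@guarded_diff_loop m.+2 (drop i.+1 s) (drop i.+1 t)) =>
  //.
- by rewrite !size_drop st.
- by rewrite size_drop -st; lia.
- by move=> w /mem_drop; apply: hs.
- by move=> w /mem_drop; apply: ht.
- by apply: DualM => //; apply: dual_sub hb.
- by apply: DualM => //; apply: dual_sub hc.
- rewrite invgM -mulgA mulKg; apply: phi_guarded => //.
  apply: hlt => //; exact: no_low_divisor_entry mN hz _.
- move=> j jt; have := nt1 (i.+1 + j); rewrite addKn; apply.
  by rewrite size_drop in jt; lia.
Qed.

(** In the inductive step, the last entries are right divisors of [x] and [y] in the smaller dual
    monoid, hence trivial. So the first difference comes earlier, and $x^{-1}y$ is the guarded braid
    itself. *)
Lemma guarded_rotating_lt m x y : m.+1 < N -> rotating_lt m.+2 x y ->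
    no_low_divisor m.+2 x -> no_low_divisor m.+2 y ->
  guarded m.+1 (x^-1 * y) y.
Proof.
elim: m x y => [|m IH] x y mN.
  move=> [b [c [-> -> bc]]] _ _; exists 1%N; split => //.
    have -> : A 1 2 = S 1 by rewrite band_def (@srun_geq 1 1) // invg1 mulg1
      mul1g.
    (* One of the [c - b] letters is set aside as the factor [S m] of [reach]. *)
    exists (S 1 ^+ (c - b.+1)), 1, 1; split; try exact: gen1;
      try exact: nonneg1.
      elim: (c - _) => [|d IH]; first exact: nonneg1.
      by rewrite expgS; apply: nonnegM IH; apply: (@nonneg_sigma 2).
    rewrite !mulg1 -expgSr; apply: (mulgI (S 1 ^+ b)).
    by rewrite mulVKg -expgnDr; congr (_ ^+ _); lia.
  have -> : c = c.-1.+1 by lia.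
  exists (A 1 2 ^+ c.-1); last by rewrite expgSr.
  elim: (c.-1) => [|d IH]; first exact: Dual1.
  by rewrite expgS; apply: DualM IH; apply: DualBand.
move=> [s [t [hs ht hst]]] nx ny.
have hlt (b c : braid N) : rotating_lt m.+2 b c -> no_low_divisor m.+2 b ->
    no_low_divisor m.+2 c -> guarded m.+1 (b^-1 * c) c.
  by apply: IH; apply: ltnW.
have [[v [w [b [c [hg hb hc Exy [hbx [Ey hw]]]]]]]|[z [b [c [hb hc hne _ [hz [Ex
  Ey]]]]]]] :=
  shortlex_guarded mN hlt hs ht hst.
  have b1 : b = 1 by apply: no_low_divisor_dual hb nx hbx.
  have c1 : c = 1 by apply: no_low_divisor_dual hc ny _; rewrite Ey;
    apply: rd_mulr.
  by rewrite Exy Ey b1 c1 invg1 mul1g !mulg1.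
case: hne; have -> : b = 1.
  by apply: no_low_divisor_dual hb nx _; rewrite Ex; apply: rd_mulr.
by apply/esym; apply: no_low_divisor_dual hc ny _; rewrite Ey; apply: rd_mulr.
Qed.

(** * Words witnessing sigma-positivity *)

Lemma gen_word m x : m <= N -> gen 1 m x ->
  exists2 w : word N, braid_of w = x & all (fun l => val l.1 < m) w.
Proof.
move=> mN; elim=> [|j hj|y z _ [v <- hv] _ [w <- hw]|y _ [w <- hw]].
- by exists [::].
- have hj' : 0 < j < N by lia.
  by rewrite (sigma_in hj'); eexists; first reflexivity; rewrite /= andbT; lia.
- by exists (v ++ w); rewrite ?mul_braid_of // all_cat hv.
- exists (winv w); first by rewrite braid_of_inv.
  by rewrite /winv all_rev all_map.
Qed.

Lemma nonneg_word m x : m < N -> nonneg m.+1 x ->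
  exists2 w : word N, braid_of w = x &
    all (fun l => (val l.1 <= m) && ((val l.1 == m) ==> l.2)) w.
Proof.
move=> mN hx; have gw y : gen 1 m y -> exists2 w : word N, braid_of w = y &
    all (fun l => (val l.1 <= m) && ((val l.1 == m) ==> l.2)) w.
  move=> /(gen_word (ltnW mN))[w <- hw]; exists w => //.
  by apply: sub_all hw => l /= hl; rewrite ltnW //= ltn_eqF.
elim: hx => [y /gw//|y z /gw[v <- hv] _ [w <- hw]].
rewrite [m.+1.-1]/=; case: (posnP m) => m0.
  have -> : S m = 1 by rewrite m0 sigma_oob.
  rewrite mulg1.
  by exists (v ++ w); rewrite ?mul_braid_of // all_cat hv.
have hm : 0 < m < N by rewrite m0.
rewrite (sigma_in hm) !mul_braid_of; eexists; first reflexivity.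
by rewrite !all_cat hv hw /= leqnn implybT.
Qed.

Lemma sigma_positive_mid m x y : 0 < m -> m < N ->
  nonneg m.+1 x -> nonneg m.+1 y -> sigma_positive (x * S m * y).
Proof.
move=> m0 mN /(nonneg_word mN)[v <- hv] /(nonneg_word mN)[w <- hw].
have hm : 0 < m < N by rewrite m0.
exists (exist _ m hm), (v ++ [:: (exist _ m hm : sigma_index N, true)] ++ w).
split; last by rewrite (sigma_in hm) !mul_braid_of catA.
have hall : all (fun l : letter N => (val l.1 <= m) && ((val l.1 == m) ==> l.2))
    (v ++ [:: (exist _ m hm : sigma_index N, true)] ++ w).
  by rewrite !all_cat hv hw /= leqnn implybT.
rewrite /positive_word; apply/and3P; split.
- by rewrite !mem_cat mem_head orbT.
- by apply/negP => /(allP hall); rewrite /= eqxx andbF.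
- by apply: sub_all hall => l /andP[].
Qed.

Lemma guarded_sigma_positive m v w (b c : braid N) : 0 < m -> m < N ->
  guarded m v w ->
  gen 1 m b -> gen 1 m c -> sigma_positive (b * v * c).
Proof.
move=> m0 mN [p [/andP[p0 pm] [z [g [k [hz hg hk ->]]]] _]] hb hc.
have -> : b * (z * S m * g * k) * c = (b * z) * S m * (g * k * c) by rewrite
  !mulgA.
apply: sigma_positive_mid => //; first by apply: nonnegM => //;
  apply: nonneg_gen.
apply/nonneg_gen/genM => //; apply: genM; first exact: gen_sub hg.
by apply: gen_sub (nonneg_sub hk).
Qed.

Lemma rotating_lt_sigma_positive m x y : m <= N -> rotating_lt m x y ->
  sigma_positive (x^-1 * y).
Proof.
case: m => [|[|m]] //; elim: m x y => [|m IH] x y mN hxy.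
  have := @guarded_sigma_positive 1 (x^-1 * y) y 1 1.
  rewrite mul1g mulg1; apply => //; try exact: gen1.
  (* No [t], [u] satisfy [0 < t < u < 2], so both divisor conditions are vacuous. *)
  by apply: guarded_rotating_lt => //; case=> // t [|[]].
case: hxy => [s [t [hs ht hst]]].
have hlt (b c : braid N) : rotating_lt m.+2 b c -> no_low_divisor m.+2 b ->
    no_low_divisor m.+2 c -> guarded m.+1 (b^-1 * c) c.
  by apply: guarded_rotating_lt; apply: ltnW.
have [[v [w [b [c [hg hb hc -> _]]]]]|[z [b [c [hb hc _ hbc [_ [-> ->]]]]]]] :=
  shortlex_guarded mN hlt hs ht hst.
  by apply: guarded_sigma_positive hg _ _ => //;
    [apply/genV/dual_gen|apply: dual_gen].
(* The common left factor cancels, leaving the last entries, one rank lower. *)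
by rewrite invgM -mulgA mulKg; apply: IH => //; apply: ltnW.
Qed.

End Braids.

Theorem theorem2p8 (n : nat) (hn : 2 <= n) (x y : braid n)
    (hx : dual n x) (hy : dual n y) :
  rotating_lt n x y -> braid_lt x y.
Proof. exact: rotating_lt_sigma_positive. Qed.
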